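(* There exist absolute constants $C,c>0$ such that the following holds. Let $G=\mathrm{SL}(2,q)$, let $t\ge 2$ be an integer, and let $A,B\subseteq G^t$ be nonempty sets of densities $\alpha=|A|/|G|^t$ and $\beta=|B|/|G|^t$. Let $g\in G$. If $a$ and $b$ are selected uniformly and independently from $A$ and $B$ respectively, then \[\left|\Pr[a\bullet b=g]-\frac{1}{|G|}\right|\le C(\alpha\beta)^{-1}|G|^{-ct}\cdot\frac{1}{|G|}.\]
   Context: For tuples $a=(a_1,\dots,a_t)$ and $b=(b_1,\dots,b_t)$ in $G^t$, the interleaved product is $a\bullet b:=a_1b_1a_2b_2\cdots a_tb_t\in G$. $\mathrm{SL}(2,q)$ is the group of $2\times 2$ matrices of determinant $1$ over the finite field $\mathbb F_q$.
   Formalization: The result is proved for q ≥ 4; for q = 2, 3 it is false, since SL(2,q) then has a nontrivial abelian quotient, which gives sets A, B of constant density whose error is at least 1/|G| for every t. *)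

(* Defs.v *)
From HB Require Import structures.
From mathcomp Require Import all_boot all_order all_algebra all_fingroup.
From Stdlib Require Import Reals.
Set Implicit Arguments. Unset Strict Implicit. Unset Printing Implicit Defensive.

Local Open Scope ring_scope.

Definition SL2 (F : finFieldType) : {set {'GL_2[F]}} :=
  [set g : {'GL_2[F]} | \det (GLval g) == 1].

Local Open Scope group_scope.

Definition ilprod (gT : finGroupType) (t : nat) (a b : t.-tuple gT) : gT :=
  \prod_(i < t) (tnth a i * tnth b i).

Definition nsol (gT : finGroupType) (t : nat) (A B : {set t.-tuple gT}) (g : gT) : nat :=
  #|[set ab in setX A B | ilprod ab.1 ab.2 == g]|.

(* Main.v *)
Require Import Defs.
From Stdlib Require Import Reals Lra.
From HB Require Import structures.
From mathcomp Require Import all_boot all_order all_algebra all_fingroup.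
From mathcomp Require Import all_field all_character.

Set Implicit Arguments. Unset Strict Implicit. Unset Printing Implicit Defensive.
Import Order.TTheory GRing.Theory Num.Theory.

(** Expand [1[w = 1] - 1/|G|] in the nontrivial irreducible characters [chi] of a finite
    group [G].  The kernels [chi(a • b)] on [G^t x G^t] satisfy
    [sum_a chi(a • b) conj(psi(a • b')) = 0] for [chi <> psi] and
    [= (|G| / chi(1))^t prod_k chi(b_k b'_k^-1)] for [chi = psi], and the kernels
    [prod_k (chi(1) / |G|) chi(b_k b'_k^-1)] are mutually orthogonal projections.
    By Cauchy-Schwarz, [1[a • b = g] - 1/|G|] thus has operator norm at most
    [(|G| / m)^(t-1)], where [m] is the least degree of a nontrivial irreducible character.
    For [SL(2,q)] one has [m >= (q-1)/2]: the restriction of such a character to the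
    unipotent group contains a nontrivial linear character, hence all of its conjugates
    under the diagonal torus. *)

(** * Real estimates: from cleared denominators to densities *)

Section RealBounds.
Local Open Scope R_scope.

(** [n], [q1], [s] stand for |G|, q - 1, t - 1. For y = [q1 / 2] >= 3/2 one has 2y + 1 <= y^4, hence
    n <= y^16; the exponent (s+1)/32 on n costs at most (s+1)/2 <= s on y. *)
Lemma Rpower_le_half_pow (n q1 : R) (s : nat) :
    0 < n -> 3 <= q1 -> n <= (q1 + 1) ^ 4 -> 1 <= INR s ->
  Rpower n (1 / 32 * INR (S s)) <= (q1 / 2) ^ s.
Proof.
intros n0 q3 nq s1; set (y := q1 / 2).
assert (y1 : 3 / 2 <= y) by (unfold y; lra).
assert (ny : n <= y ^ 16).
{ apply Rle_trans with (1 := nq).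
  replace (y ^ 16) with ((y ^ 4) ^ 4) by ring.
  apply pow_incr; split; [lra|].
  replace (q1 + 1) with (2 * y + 1) by (unfold y; field).
  assert (9 / 4 <= y * y) by nra.
  assert (27 / 8 <= y * (y * y)) by nra.
  replace (y ^ 4) with (y * (y * (y * y))) by ring.
  nra. }
assert (c0 : 0 <= 1 / 32 * INR (S s)) by (rewrite S_INR; lra).
apply Rle_trans with (Rpower (y ^ 16) (1 / 32 * INR (S s))).
  apply Rle_Rpower_l; [exact c0 | split; assumption].
rewrite <- (Rpower_pow 16 y), Rpower_mult, <- (Rpower_pow s y) by lra.
apply Rle_Rpower; [lra|].
replace (INR 16) with 16 by (simpl; lra); rewrite S_INR; lra.
Qed.

(** Dividing by [n * (a * b)] leaves the factor (2 / q1)^s, which the previous estimate turns into a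
    negative power of [n]. *)
Lemma density_bound (N n a b q1 : R) (s : nat) :
    0 < n -> 0 < a -> 0 < b ->
    3 <= q1 -> n <= (q1 + 1) ^ 4 -> 1 <= INR s ->
    Rabs (N * n - a * b) * q1 ^ s <= 2 ^ s * (n ^ S s * n ^ S s) ->
  Rabs (N / (a * b) - / n)
    <= 1 * / (a / n ^ S s * (b / n ^ S s)) * Rpower n (- (1 / 32 * INR (S s))) * / n.
Proof.
intros n0 a0 b0 q3 nq s1 H.
assert (nt0 : 0 < n ^ S s) by (apply pow_lt; exact n0).
assert (P0 := Rpower_le_half_pow n0 q3 nq s1).
rewrite Rpower_Ropp; set (P := Rpower n (1 / 32 * INR (S s))) in *.
assert (Pgt0 : 0 < P) by apply exp_pos.
assert (X : Rabs (N * n - a * b) * P <= n ^ S s * n ^ S s).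
{ apply Rmult_le_reg_r with (2 ^ s); [apply pow_lt; lra|].
  rewrite (Rmult_comm (n ^ S s * n ^ S s)).
  apply Rle_trans with (2 := H).
  rewrite Rmult_assoc; apply Rmult_le_compat_l; [apply Rabs_pos|].
  replace q1 with (q1 / 2 * 2) by field.
  rewrite Rpow_mult_distr; apply Rmult_le_compat_r; [apply pow_le; lra | exact P0]. }
replace (N / (a * b) - / n) with ((N * n - a * b) * / (n * (a * b))) by (field; lra).
rewrite Rabs_mult; rewrite (Rabs_pos_eq (/ _)).
2: { apply Rlt_le, Rinv_0_lt_compat; repeat apply Rmult_lt_0_compat; assumption. }
replace (1 * / (a / n ^ S s * (b / n ^ S s)) * / P * / n)
  with ((n ^ S s * n ^ S s) / P * / (n * (a * b))) by (field; lra).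
apply Rmult_le_compat_r.
{ apply Rlt_le, Rinv_0_lt_compat; repeat apply Rmult_lt_0_compat; assumption. }
apply Rmult_le_reg_r with P; [exact Pgt0|].
replace (n ^ S s * n ^ S s / P * P) with (n ^ S s * n ^ S s) by (field; lra).
exact X.
Qed.

End RealBounds.

From mathcomp Require Import ring.

(** * Character sums, orthogonal kernels and mixing for a general finite group *)

Section InterleavedMixing.

Variables (gT : finGroupType) (G : {group gT}).
Local Open Scope group_scope.
Local Open Scope ring_scope.

Local Notation n := (#|G|%:R : algC).
Local Notation d i := ('chi[G]_i 1%g).

Lemma cfunMC (phi : 'CF(G)) x y : x \in G -> phi (x * y)%g = phi (y * x)%g.
Proof. by move=> Gx; rewrite -(cfunJ phi (x * y)%g Gx) conjgE -mulgA mulKg. Qed.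

(** Shifting [a] by [y^-1] reduces this to the generalized orthogonality relation. *)
Lemma sum_irr_mul_conj (i j : Iirr G) x y : x \in G -> y \in G ->
  \sum_(a in G) 'chi_i (a * x)%g * ('chi_j (a * y)%g)^*
    = (i == j)%:R * (n / d i) * 'chi_i (y^-1 * x)%g.
Proof.
move=> Gx Gy; have := generalized_orthogonality_relation (y^-1 * x)%g i j.
move/(canRL (mulVKf (neq0CG G))) => H.
transitivity (\sum_(a in G) 'chi_i (a * (y^-1 * x))%g * 'chi_j a^-1%g); last first.
  by rewrite H; ring.
rewrite (reindex_inj (mulIg y^-1%g)) /=; apply: eq_big => [a|a _].
  by rewrite groupMr ?groupV.
by rewrite irr_inv mulgKV mulgA.
Qed.

(** As a function of [v] the sum is a class function, and by orthogonality only its coefficient at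
    ['chi_i] can be nonzero. *)
Lemma sum_irr_conjg (i : Iirr G) u v : u \in G -> v \in G ->
  \sum_(a in G) 'chi_i (u ^ a * v)%g = (n / d i) * ('chi_i u * 'chi_i v).
Proof.
move=> Gu Gv.
have cF : is_class_fun <<G>> [ffun w => \sum_(a in G) 'chi_i (u ^ a * w)%g].
  rewrite genGid; apply: intro_class_fun => [x y Gx Gy | x G'x]; last first.
    by apply: big1 => a Ga; rewrite cfun0 // groupMl ?groupJ.
  rewrite (reindex_inj (mulIg y)) /=; apply: eq_big => [a|a Ga].
    by rewrite groupMr.
  by rewrite conjgM -conjMg cfunJ.
pose f : 'CF(G) := Cfun 0 cF.
have cf j : '[f, 'chi_j] = (i == j)%:R * ('chi_i u / d i) * n.
  rewrite cfdotE.
  under eq_bigr => w Gw do rewrite cfunE mulr_suml.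
  rewrite exchange_big /= (eq_bigr (fun=> (i == j)%:R * (n / d i) * 'chi_i u)).
    rewrite sumr_const -mulr_natl; have := neq0CG G; have := irr1_neq0 i.
    by move=> ? ?; field; apply/andP.
  move=> a Ga; rewrite (eq_bigr (fun w => 'chi_i (w * u ^ a)%g * ('chi_j (w * 1)%g)^*)).
    by rewrite sum_irr_mul_conj ?groupJ // invg1 mul1g cfunJ.
  by move=> w Gw; rewrite mulg1 cfunMC ?groupJ.
have -> : \sum_(a in G) 'chi_i (u ^ a * v)%g = f v by rewrite cfunE.
rewrite [f]cfun_sum_cfdot sum_cfunE (bigD1 i) //= big1 => [|j ne_ji].
  rewrite !cfunE cf eqxx mul1r addr0; ring.
by rewrite cfunE cf eq_sym (negPf ne_ji) !mul0r.
Qed.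

(** G^t, kept inside the tuples over [gT] because SL(2) will be a subgroup of the ambient GL(2). *)
Definition tuples_in t : {set t.-tuple gT} := [set a : t.-tuple gT | all (mem G) a].

Lemma tuples_inP t (a : t.-tuple gT) :
  reflect (forall k, tnth a k \in G) (a \in tuples_in t).
Proof. by rewrite inE; apply: all_tnthP. Qed.

Lemma sum_tuples_in_cons t (F : t.+1.-tuple gT -> algC) :
  \sum_(a in tuples_in t.+1) F a
    = \sum_(x in G) \sum_(a in tuples_in t) F [tuple of x :: a].
Proof.
rewrite pair_big /= (reindex (fun p : gT * t.-tuple gT => [tuple of p.1 :: p.2])) /=.
  by apply: eq_bigl => -[x a]; rewrite !inE.
exists (fun a => (thead a, [tuple of behead a])) => [[x a] _|a _] /=.
  by congr pair; apply: val_inj.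
by rewrite [a in RHS]tuple_eta.
Qed.

Variant tuples_in_cons_spec t : t.+1.-tuple gT -> Prop :=
  TuplesInCons x a of x \in G & a \in tuples_in t :
    tuples_in_cons_spec [tuple of x :: a].

Lemma tuples_in_consP t (a : t.+1.-tuple gT) :
  a \in tuples_in t.+1 -> tuples_in_cons_spec a.
Proof.
by rewrite [a]tuple_eta !inE /= => /andP[Gx Ga]; constructor; rewrite ?inE.
Qed.

Lemma ilprod_cons t x y (a b : t.-tuple gT) :
  ilprod [tuple of x :: a] [tuple of y :: b] = (x * y * ilprod a b)%g.
Proof.
rewrite /ilprod big_ord_recl !tnth0; congr (_ * _)%g.
by apply: eq_bigr => k _; rewrite !tnthS.
Qed.

Lemma ilprod_in t (a b : t.-tuple gT) :
  a \in tuples_in t -> b \in tuples_in t -> ilprod a b \in G.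
Proof.
by move=> /tuples_inP Ga /tuples_inP Gb; apply: group_prod => k _; rewrite groupM.
Qed.

(** Up to duality, the kernel of the projection of functions on G^t onto the isotypic component of
    the t-fold outer tensor power of ['chi_i]. *)
Definition irr_ker t (i : Iirr G) (a b : t.-tuple gT) : algC :=
  \prod_(k < t) (d i / n * 'chi_i (tnth a k * (tnth b k)^-1)%g).

Lemma irr_ker_cons t i x y (a b : t.-tuple gT) :
  irr_ker i [tuple of x :: a] [tuple of y :: b]
    = d i / n * 'chi_i (x * y^-1)%g * irr_ker i a b.
Proof.
rewrite /irr_ker big_ord_recl !tnth0; congr (_ * _).
by apply: eq_bigr => k _; rewrite !tnthS.
Qed.

Lemma irr_kerC t i (a b : t.-tuple gT) : irr_ker i b a = (irr_ker i a b)^*.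
Proof.
rewrite rmorph_prod; apply: eq_bigr => k _.
rewrite rmorphM fmorph_div rmorph_nat /= (conj_natr (Cnat_irr1 i)) -irr_inv.
by rewrite invMg invgK.
Qed.

(** In one coordinate this is the orthogonality of central idempotents; coordinates multiply. The
    power [t] of the delta also covers empty tuples, where every kernel is 1. *)
Lemma irr_ker_conv t i j (x z : t.-tuple gT) :
    x \in tuples_in t -> z \in tuples_in t ->
  \sum_(y in tuples_in t) irr_ker i x y * irr_ker j y z
    = (i == j)%:R ^+ t * irr_ker i x z.
Proof.
have conv1 a c : a \in G -> c \in G ->
    \sum_(b in G) (d i / n * 'chi_i (a * b^-1)%g) * (d j / n * 'chi_j (b * c^-1)%g)
      = (i == j)%:R * (d i / n * 'chi_i (a * c^-1)%g).
  move=> Ga Gc.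
  transitivity (d i / n * (d j / n) *
      \sum_(b in G) 'chi_i (b * a)%g * ('chi_j (b * c)%g)^*).
    rewrite mulr_sumr (reindex_inj invg_inj) /=.
    apply: eq_big => [b|b]; rewrite groupV // => Gb.
    by rewrite invgK -irr_inv invMg (cfunMC _ b Ga) (@cfunMC _ c^-1%g) ?groupV //; ring.
  rewrite sum_irr_mul_conj // (cfunMC _ a) ?groupV //.
  have [->|_] := eqVneq i j; last by rewrite !mul0r mulr0.
  by have := neq0CG G; have := irr1_neq0 j => ? ?; field; apply/andP.
elim: t x z => [|t IHt] x z.
  move=> _ _; rewrite (eq_bigr (fun=> 1)) => [|y _].
    rewrite sumr_const mul1r /irr_ker !big_ord0.
    rewrite (_ : tuples_in 0 = setT) ?cardsT ?card_tuple //.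
    by apply/setP=> a; rewrite !inE tuple0.
  by rewrite /irr_ker !big_ord0 mulr1.
case/tuples_in_consP=> {}x x' Gx Gx' /tuples_in_consP[{}z z' Gz Gz'].
rewrite sum_tuples_in_cons irr_ker_cons exprS mulrACA -conv1 // -IHt // mulr_suml.
apply: eq_bigr => y Gy; rewrite mulr_sumr; apply: eq_bigr => y' _.
by rewrite !irr_ker_cons mulrACA.
Qed.

(** Peeling off the first coordinate x replaces [w] by [y'^-1 * w ^ x * y], so a free [w] lets the
    induction run; the sum over x then splits off ['chi_i (y * y'^-1)]. *)
Lemma sum_irr_conj_ilprod t i w (b b' : t.-tuple gT) :
    w \in G -> b \in tuples_in t -> b' \in tuples_in t ->
  \sum_(a in tuples_in t) 'chi_i ((ilprod a b')^-1 * w * ilprod a b)%g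
    = (n / d i) ^+ (2 * t) * 'chi_i w * irr_ker i b b'.
Proof.
elim: t w b b' => [|t IHt] w b b' Gw.
  move=> _ _; rewrite (eq_bigr (fun=> 'chi_i w)) => [|a _].
    rewrite sumr_const muln0 expr0 mul1r /irr_ker !big_ord0 mulr1.
    rewrite (_ : tuples_in 0 = setT) ?cardsT ?card_tuple //.
    by apply/setP=> a; rewrite !inE tuple0.
  by rewrite /ilprod !big_ord0 invg1 mulg1 mul1g.
case/tuples_in_consP=> y {}b Gy Gb /tuples_in_consP[y' {}b' Gy' Gb'].
rewrite sum_tuples_in_cons.
transitivity (\sum_(x in G) (n / d i) ^+ (2 * t) * irr_ker i b b' *
    'chi_i (w ^ x * (y * y'^-1))%g).
  apply: eq_bigr => x Gx.
  transitivity ((n / d i) ^+ (2 * t) * 'chi_i (y'^-1 * (w ^ x * y))%g * irr_ker i b b').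
    rewrite -IHt ?groupM ?groupV ?groupJ //; apply: eq_bigr => a Ga.
    by rewrite !ilprod_cons !invMg conjgE !mulgA.
  by rewrite cfunMC ?groupV // !mulgA mulrAC.
rewrite -mulr_sumr sum_irr_conjg ?groupM ?groupV // irr_ker_cons mulnS exprD.
by have := neq0CG G; have := irr1_neq0 i => ? ?; field; apply/andP.
Qed.

(** The sum over the first coordinate, cycled to the front, separates i from j; what remains is the
    conjugated sum above with w = [y'^-1 * y]. *)
Lemma sum_irr_ilprod t i j u (b b' : t.+1.-tuple gT) :
    u \in G -> b \in tuples_in t.+1 -> b' \in tuples_in t.+1 ->
  \sum_(a in tuples_in t.+1)
      'chi_i (u * ilprod a b)%g * ('chi_j (u * ilprod a b')%g)^*
    = (i == j)%:R * (n / d i) ^+ (2 * t.+1) * irr_ker i b b'.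
Proof.
move=> Gu /tuples_in_consP[y {}b Gy Gb] /tuples_in_consP[y' {}b' Gy' Gb'].
rewrite sum_tuples_in_cons exchange_big /=.
transitivity (\sum_(a in tuples_in t) (i == j)%:R * (n / d i) *
    'chi_i ((ilprod a b')^-1 * (y'^-1 * y) * ilprod a b)%g).
  apply: eq_bigr => a Ga; have GA := ilprod_in Ga Gb; have GA' := ilprod_in Ga Gb'.
  transitivity (\sum_(x in G) 'chi_i (x * (y * ilprod a b * u))%g *
      ('chi_j (x * (y' * ilprod a b' * u))%g)^*).
    by apply: eq_bigr => x Gx; rewrite !ilprod_cons !(cfunMC _ _ Gu) !mulgA.
  rewrite sum_irr_mul_conj ?groupM //; congr (_ * _).
  by rewrite !invMg -!mulgA cfunMC ?groupV // -!mulgA mulgV mulg1.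
rewrite -mulr_sumr sum_irr_conj_ilprod ?groupM ?groupV // irr_ker_cons.
rewrite cfunMC ?groupV // mulnS exprD.
by have := neq0CG G; have := irr1_neq0 i => ? ?; field; apply/andP.
Qed.

(** This is the regular character divided by |G|, less its principal term. *)
Lemma sum_nontriv_irr w : w \in G ->
  \sum_(i : Iirr G | i != 0) d i / n * 'chi_i w = (w == 1%g)%:R - n^-1.
Proof.
move=> Gw; have := congr1 (fun phi : 'CF(G) => phi w / n) (cfReg_sum G).
rewrite cfRegE mulrnAl divff ?neq0CG // sum_cfunE mulr_suml (bigD1 0) //=.
rewrite irr0 !cfunE cfun11 cfun1E Gw !mul1r => ->; rewrite [RHS]addrC addKr.
by apply: eq_bigr => i _; rewrite cfunE mulrAC.
Qed.

(** For nonempty tuples, the squared norm of the projection of the indicator 1_B. *)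
Definition irr_form t (B : {set t.-tuple gT}) (i : Iirr G) : algC :=
  \sum_(b in B) \sum_(b' in B) irr_ker i b b'.

(** Hermitian symmetry turns the sum over z into a composition of kernels. Length [t.+1] makes the
    power of the delta collapse to the delta. *)
Lemma sum_irr_ker_conj t i j (B : {set t.+1.-tuple gT}) :
    B \subset tuples_in t.+1 ->
  \sum_(z in tuples_in t.+1)
      (\sum_(b in B) irr_ker i b z) * (\sum_(b in B) irr_ker j b z)^*
    = (i == j)%:R * irr_form B i.
Proof.
move=> sBG; have BG b : b \in B -> b \in tuples_in t.+1 by apply: subsetP.
transitivity (\sum_(b in B) \sum_(b' in B) \sum_(z in tuples_in t.+1)
    irr_ker i b z * irr_ker j z b').
  under eq_bigr => z _ do rewrite rmorph_sum big_distrlr /=.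
  rewrite exchange_big; apply: eq_bigr => b _.
  rewrite exchange_big; apply: eq_bigr => b' _.
  by apply: eq_bigr => z _; rewrite [irr_ker j z b']irr_kerC.
rewrite /irr_form mulr_sumr; apply: eq_bigr => b Bb.
rewrite mulr_sumr; apply: eq_bigr => b' Bb'.
by rewrite irr_ker_conv ?BG //; case: eqP; rewrite ?expr1n // expr0n.
Qed.

Lemma irr_form_ge0 t (B : {set t.+1.-tuple gT}) i :
  B \subset tuples_in t.+1 -> 0 <= irr_form B i.
Proof.
move=> sBG; have := sum_irr_ker_conj i i sBG; rewrite eqxx mul1r => <-.
by apply: sumr_ge0 => z _; rewrite -normCK exprn_ge0.
Qed.

(* Bessel's inequality for the orthogonal projections with kernels [irr_ker i]. *)
Lemma sum_irr_form_le t (B : {set t.+1.-tuple gT}) :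
  B \subset tuples_in t.+1 -> \sum_i irr_form B i <= #|B|%:R.
Proof.
move=> sBG; set Q := \sum_i _.
have Qr : Q \is Num.real by apply: ger0_real; apply: sumr_ge0 => i _; apply: irr_form_ge0.
(* [w] is the sum of all projections of 1_B. Its inner products with 1_B and with itself both equal
   Q, so 1_B - w has squared norm |B| - Q. *)
pose w z := \sum_i \sum_(b in B) irr_ker i b z.
have wE : \sum_(z in B) w z = Q.
  rewrite /w exchange_big; apply: eq_bigr => i _; rewrite exchange_big.
  by apply: eq_bigr.
have restrB (f : t.+1.-tuple gT -> algC) :
    \sum_(z in tuples_in t.+1) (z \in B)%:R * f z = \sum_(z in B) f z.
  under eq_bigr => z _ do rewrite mulr_natl mulrb.
  rewrite -big_mkcondr; apply: eq_bigl => z.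
  by rewrite andb_idl // => /(subsetP sBG).
have wwE : \sum_(z in tuples_in t.+1) w z * (w z)^* = Q.
  under eq_bigr => z _ do rewrite rmorph_sum big_distrlr /=.
  rewrite exchange_big; apply: eq_bigr => i _.
  rewrite exchange_big (bigD1 i) //= sum_irr_ker_conj // eqxx mul1r.
  rewrite big1 ?addr0 // => j.
  by rewrite eq_sym sum_irr_ker_conj // => /negPf->; rewrite mul0r.
have : 0 <= \sum_(z in tuples_in t.+1) `|(z \in B)%:R - w z| ^+ 2.
  by apply: sumr_ge0 => z _; rewrite exprn_ge0.
have -> : \sum_(z in tuples_in t.+1) `|(z \in B)%:R - w z| ^+ 2 = #|B|%:R - Q.
  transitivity (\sum_(z in tuples_in t.+1) ((z \in B)%:R * (1 - w z - (w z)^*)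
      + w z * (w z)^*)).
    apply: eq_bigr => z _; rewrite normCK rmorphB rmorph_nat.
    by case: (z \in B); rewrite /=; ring.
  have wE' : \sum_(z in B) (w z)^* = Q by rewrite -(conj_Creal Qr) -wE rmorph_sum.
  by rewrite big_split /= wwE restrB !sumrB wE wE' sumr_const subrK.
by rewrite subr_ge0.
Qed.

(** Cauchy-Schwarz against the constant 1, read off from the nonnegative sum of
    [(k * f x - S) ^+ 2]. *)
Lemma sqr_sum_le (I : finType) (A : {set I}) (f : I -> algC) :
    (forall x, x \in A -> f x \is Num.real) ->
  (\sum_(x in A) f x) ^+ 2 <= #|A|%:R * \sum_(x in A) f x ^+ 2.
Proof.
move=> fR; have [->|An0] := eqVneq A set0.
  by rewrite !big_set0 expr0n mulr0.
set S := \sum_(x in A) f x; set k : algC := #|A|%:R.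
have k_gt0 : 0 < k by rewrite ltr0n card_gt0.
have SR : S \is Num.real by apply: rpred_sum.
have : 0 <= \sum_(x in A) (k * f x - S) ^+ 2.
  apply: sumr_ge0 => x Ax; rewrite real_exprn_even_ge0 //.
  by rewrite rpredB // rpredM ?fR // rpred_nat.
have -> : \sum_(x in A) (k * f x - S) ^+ 2 = k * (k * \sum_(x in A) f x ^+ 2 - S ^+ 2).
  transitivity (\sum_(x in A) (k ^+ 2 * f x ^+ 2 - 2 * k * S * f x + S ^+ 2)).
    by apply: eq_bigr => x _; ring.
  by rewrite big_split sumrB /= -!mulr_sumr sumr_const -/S -mulr_natl -/k; ring.
by rewrite pmulr_rge0 // subr_ge0.
Qed.

(** The bound stays squared, which avoids square roots; [t] is the tuple length minus one. *)
Theorem interleaved_mixing (m : algC) t (A B : {set t.+1.-tuple gT}) g :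
    0 < m -> (forall i : Iirr G, i != 0 -> m <= d i) ->
    A \subset tuples_in t.+1 -> B \subset tuples_in t.+1 -> g \in G ->
  ((nsol A B g)%:R - #|A|%:R * #|B|%:R / n) ^+ 2
    <= #|A|%:R * #|B|%:R * (n / m) ^+ (2 * t).
Proof.
move=> m_gt0 le_m sAG sBG Gg.
have AG a : a \in A -> a \in tuples_in t.+1 by apply: subsetP.
have BG b : b \in B -> b \in tuples_in t.+1 by apply: subsetP.
pose D (a b : t.+1.-tuple gT) :=
  \sum_(i : Iirr G | i != 0) d i / n * 'chi_i (g^-1 * ilprod a b)%g.
have DE a b : a \in tuples_in t.+1 -> b \in B -> D a b = (ilprod a b == g)%:R - n^-1.
  move=> Ga Bb; have Gw : (g^-1 * ilprod a b)%g \in G.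
    by rewrite groupM ?groupV // ilprod_in // BG.
  rewrite /D sum_nontriv_irr //.
  by rewrite -eq_mulVg1 eq_sym.
pose s a := \sum_(b in B) D a b.
have sR : {in tuples_in t.+1, forall a, s a \is Num.real}.
  move=> a Ga; apply: rpred_sum => b Bb; rewrite DE // rpredB ?rpred_nat //.
  by rewrite rpredV rpred_nat.
have -> : (nsol A B g)%:R - #|A|%:R * #|B|%:R / n = \sum_(a in A) s a.
  transitivity (\sum_(a in A) \sum_(b in B) ((ilprod a b == g)%:R - n^-1)).
    under eq_bigr => a _ do rewrite sumrB sumr_const.
    rewrite sumrB sumr_const -mulrnA -[_ *+ (_ * _)]mulr_natl natrM; congr (_ - _).
      rewrite pair_big /nsol -sum1_card natr_sum; under [RHS]eq_bigr do rewrite mulrb.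
      by rewrite -big_mkcondr; apply: eq_bigl => ab; rewrite !inE.
    by rewrite [_ * #|A|%:R]mulrC.
  by apply: eq_bigr => a Aa; apply: eq_bigr => b Bb; rewrite DE ?AG.
(* After Cauchy-Schwarz over A, the sum of squares is enlarged to all of G^t, where orthogonality in
   [a] applies. *)
apply: le_trans (sqr_sum_le (fun a Aa => sR a (AG a Aa))) _.
rewrite -mulrA ler_wpM2l //.
apply: (@le_trans _ _ (\sum_(a in tuples_in t.+1) s a ^+ 2)).
  rewrite [leRHS](big_setID A) /= (setIidPr sAG) lerDl sumr_ge0 // => a.
  by rewrite inE => /andP[_ Ga]; rewrite real_exprn_even_ge0 ?sR.
have -> : \sum_(a in tuples_in t.+1) s a ^+ 2
    = \sum_(i : Iirr G | i != 0) (n / d i) ^+ (2 * t) * irr_form B i.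
  transitivity (\sum_(b in B) \sum_(b' in B) \sum_(a in tuples_in t.+1) D a b * (D a b')^*).
    transitivity (\sum_(a in tuples_in t.+1) \sum_(b in B) \sum_(b' in B) D a b * (D a b')^*).
      apply: eq_bigr => a Ga.
      by rewrite expr2 -[X in _ * X](conj_Creal (sR _ Ga)) rmorph_sum big_distrlr.
    by rewrite exchange_big; apply: eq_bigr => b _; rewrite exchange_big.
  rewrite /irr_form; under [RHS]eq_bigr => i _ do rewrite mulr_sumr.
  rewrite [RHS]exchange_big; apply: eq_bigr => b Bb.
  under [RHS]eq_bigr => i _ do rewrite mulr_sumr.
  rewrite [RHS]exchange_big; apply: eq_bigr => b' Bb'.
  transitivity (\sum_(a in tuples_in t.+1) \sum_(i : Iirr G | i != 0)
      \sum_(j : Iirr G | j != 0) (d i / n * 'chi_i (g^-1 * ilprod a b)%g) *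
         (d j / n * 'chi_j (g^-1 * ilprod a b')%g)^*).
    by apply: eq_bigr => a _; rewrite /D rmorph_sum big_distrlr.
  rewrite exchange_big; apply: eq_bigr => i ne_i0.
  rewrite exchange_big.
  transitivity (\sum_(j | j != 0) d i / n * (d j / n) *
     ((i == j)%:R * (n / d i) ^+ (2 * t.+1) * irr_ker i b b')).
    apply: eq_bigr => j _; rewrite -(@sum_irr_ilprod _ _ _ g^-1%g) ?groupV ?BG //.
    rewrite mulr_sumr; apply: eq_bigr => a _.
    by rewrite rmorphM fmorph_div rmorph_nat /= (conj_natr (Cnat_irr1 j)) mulrACA.
  rewrite (bigD1 i) //= big1 ?addr0 => [|j /andP[_]].
    (* The prefactor [(d i / n) ^+ 2] cancels two of the [2 * t.+1] powers. *)
    rewrite eqxx mul1r mulnS exprD.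
    by have := neq0CG G; have := irr1_neq0 i => ? ?; field; apply/andP.
  by rewrite eq_sym => /negPf->; rewrite !mul0r mulr0.
(* Each degree is at least [m]; Bessel then applies once the nonnegative term i = 0 is restored. *)
apply: le_trans (_ : \sum_(i : Iirr G | i != 0) (n / m) ^+ (2 * t) * irr_form B i <= _).
  apply: ler_sum => i ne_i0; rewrite ler_wpM2r ?irr_form_ge0 // lerXn2r //.
  - by rewrite nnegrE divr_ge0 ?ler0n // ltW ?irr1_gt0.
  - by rewrite nnegrE divr_ge0 ?ler0n // ltW.
  by rewrite ler_wpM2l ?ler0n // lef_pV2 ?posrE ?irr1_gt0 ?le_m.
rewrite -mulr_sumr mulrC ler_wpM2r ?exprn_ge0 ?divr_ge0 ?ler0n ?(ltW m_gt0) //.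
apply: le_trans (sum_irr_form_le sBG).
by rewrite [leRHS](bigD1 0) //= lerDr irr_form_ge0.
Qed.

End InterleavedMixing.

(** * Restriction of characters to a subgroup *)

Section Restriction.

Variables (gT : finGroupType) (G H : {group gT}).
Local Open Scope ring_scope.

(** Otherwise the restriction is a multiple of the principal character, hence constant on H, which
    puts H in the kernel. *)
Lemma irr_Res_nontriv (i : Iirr G) :
    H \subset G -> ~~ (H \subset cfker 'chi_i) ->
  exists2 j : Iirr H, j != 0 & '['Res[H] 'chi_i, 'chi_j] != 0.
Proof.
move=> sHG nker; pose phi := 'Res[H] 'chi_i.
apply/exists_inP; apply: contraR nker; rewrite negb_exists_in => /forall_inP phi0.
have phiE : phi = '[phi, 'chi_0] *: 'chi_0.
  rewrite [LHS]cfun_sum_cfdot (bigD1 0) //= big1 ?addr0 // => k /phi0/negPn/eqP e.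
  by rewrite /phi e scale0r.
apply/subsetP=> u Hu; rewrite cfkerEirr inE -!(cfResE _ sHG) // -/phi phiE.
by rewrite irr0 !cfunE !cfun1E Hu group1.
Qed.

(** Irreducible characters of abelian H have degree 1, so the degree is the sum of the
    multiplicities, and a nonzero one is at least 1. *)
Lemma leq_card_irr_Res (i : Iirr G) (I : {set Iirr H}) :
    abelian H -> (forall j, j \in I -> '['Res[H] 'chi_i, 'chi_j] != 0) ->
  #|I|%:R <= 'chi_i 1%g.
Proof.
move=> cHH nzI; pose phi := 'Res[H] 'chi_i.
have phi_nat k : '[phi, 'chi_k] \in Num.nat.
  by rewrite Cnat_cfdot_char_irr ?cfRes_char ?irr_char.
have lin1 (k : Iirr H) : 'chi_k 1%g = 1 by apply: lin_char1; apply/char_abelianP.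
rewrite -(cfRes1 H) -/phi [phi]cfun_sum_cfdot sum_cfunE (bigID (mem I)) /=.
rewrite ler_wpDr //.
  by apply: sumr_ge0 => k _; rewrite cfunE lin1 mulr1 natr_ge0.
rewrite -sumr_const; apply: ler_sum => k /nzI; rewrite cfunE lin1 mulr1 -/phi.
by have /natrP[[|m] ->] := phi_nat k; rewrite ?eqxx // ler1n.
Qed.

End Restriction.

(** * Character degrees of SL(2,q) via unipotents and the torus *)

Section SL2Degrees.

Variable F : finFieldType.
Local Open Scope group_scope.
Local Open Scope ring_scope.

Lemma group_set_SL2 : group_set (SL2 F).
Proof.
apply/group_setP; split=> [|g h]; rewrite !inE ?det1 // => /eqP dg /eqP dh.
by rewrite det_mulmx dg dh mulr1.
Qed.
Canonical SL2_group := Group group_set_SL2.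

Lemma leq_card_SL2 : (#|SL2 F| <= #|F| ^ 4)%N.
Proof.
apply: leq_trans (max_card _) _; rewrite -(card_mx F 2 2).
exact: leq_card val_inj.
Qed.

Definition mx2 (a b c d : F) : 'M[F]_2 :=
  \matrix_(i < 2, j < 2) (if i == 0 then if j == 0 then a else b
                          else if j == 0 then c else d).

Lemma mx2_eta (A : 'M[F]_2) : A = mx2 (A 0 0) (A 0 1) (A 1 0) (A 1 1).
Proof.
have ord2E (i : 'I_2) : i = if i == 0 then 0 else 1.
  by apply: val_inj; case: i => [[|[|k]] ki].
apply/matrixP=> i j; rewrite mxE [i in LHS]ord2E [j in LHS]ord2E.
by case: ifP; case: ifP.
Qed.

Lemma mx2M a b c d a' b' c' d' :
  mx2 a b c d *m mx2 a' b' c' d'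
    = mx2 (a * a' + b * c') (a * b' + b * d') (c * a' + d * c') (c * b' + d * d').
Proof.
by rewrite [LHS]mx2_eta !mxE !big_ord_recl !big_ord0 !mxE /= !addr0.
Qed.

Lemma det_mx2 a b c d : \det (mx2 a b c d) = a * d - b * c.
Proof.
rewrite (expand_det_row _ 0) !big_ord_recl big_ord0 /cofactor !det_mx11 !mxE /=.
by rewrite expr0 expr1; ring.
Qed.

(** Total by default: a singular matrix is sent to 1, so the lemmas below carry a determinant-one
    equation. *)
Definition sl2 a b c d : {'GL_2[F]} :=
  insubd (1%g : {'GL_2[F]}) (mx2 a b c d).
Arguments sl2 (a b c d)%_R.

Lemma GLval_sl2 a b c d : a * d - b * c = 1 -> GLval (sl2 a b c d) = mx2 a b c d.
Proof. by move=> e; apply: insubdK; rewrite unfold_in /= unitmxE det_mx2 e unitr1. Qed.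

Lemma sl2_in a b c d : a * d - b * c = 1 -> sl2 a b c d \in SL2 F.
Proof. by move=> e; rewrite inE GLval_sl2 // det_mx2 e. Qed.

Lemma SL2P g : g \in SL2 F ->
  exists a b c d, a * d - b * c = 1 /\ g = sl2 a b c d.
Proof.
rewrite inE => /eqP; rewrite [GLval g]mx2_eta det_mx2 => e.
do 4!eexists; split; first exact: e.
by apply: val_inj; rewrite /= [RHS]GLval_sl2 // -mx2_eta.
Qed.

Lemma sl2M a b c d a' b' c' d' :
    a * d - b * c = 1 -> a' * d' - b' * c' = 1 ->
  (sl2 a b c d * sl2 a' b' c' d')%g
    = sl2 (a * a' + b * c') (a * b' + b * d') (c * a' + d * c') (c * b' + d * d').
Proof.
move=> e e'; apply: val_inj; rewrite [RHS]GLval_sl2.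
  by rewrite -mx2M -!GLval_sl2.
by rewrite -[RHS](mulr1 1) -{1}e -e'; ring.
Qed.

Lemma sl2_1 : sl2 1 0 0 1 = 1%g.
Proof.
apply: val_inj; rewrite [LHS]GLval_sl2; last by ring.
by rewrite [RHS]mx2_eta !mxE.
Qed.


Definition upper_unipotent x := sl2 1 x 0 1.
Definition lower_unipotent x := sl2 1 0 x 1.
Arguments upper_unipotent x%_R.
Arguments lower_unipotent x%_R.

Lemma upper_unipotent_det x : 1 * 1 - x * 0 = 1 :> F. Proof. by ring. Qed.
Lemma lower_unipotent_det x : 1 * 1 - 0 * x = 1 :> F. Proof. by ring. Qed.

Lemma upper_unipotentM x y :
  (upper_unipotent x * upper_unipotent y)%g = upper_unipotent (x + y).
Proof.
rewrite /upper_unipotent sl2M ?upper_unipotent_det //.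
by congr sl2; ring.
Qed.

Lemma upper_unipotent0 : upper_unipotent 0 = 1%g.
Proof. exact: sl2_1. Qed.

Definition unipotent_set : {set {'GL_2[F]}} := [set upper_unipotent x | x in F].

Lemma unipotentP g : reflect (exists x, g = upper_unipotent x) (g \in unipotent_set).
Proof. by apply: (iffP imsetP) => [[x _ ->]|[x ->]]; exists x. Qed.

Lemma group_set_unipotent : group_set unipotent_set.
Proof.
apply/group_setP; split=> [|_ _ /unipotentP[x ->] /unipotentP[y ->]].
  by apply/unipotentP; exists 0; rewrite upper_unipotent0.
by rewrite upper_unipotentM; apply/unipotentP; exists (x + y).
Qed.
Canonical unipotent_group := Group group_set_unipotent.

Lemma unipotent_sub_SL2 : unipotent_set \subset SL2 F.
Proof.
apply/subsetP=> _ /unipotentP[x ->].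
by rewrite sl2_in ?upper_unipotent_det.
Qed.

Lemma unipotent_abelian : abelian unipotent_set.
Proof.
apply/centsP=> _ /unipotentP[x ->] _ /unipotentP[y ->].
by rewrite /commute !upper_unipotentM addrC.
Qed.

(* The Weyl element conjugates the upper unipotents to the lower ones, and together
   these generate SL(2). *)
Lemma normal_unipotent_SL2 (K : {group {'GL_2[F]}}) :
  K <| SL2 F -> unipotent_set \subset K -> SL2 F \subset K.
Proof.
move=> /andP[_ nK] sUK.
have Ku x : upper_unipotent x \in K by apply: (subsetP sUK); apply/unipotentP; exists x.
have wdet : 0 * 0 - 1 * - 1 = 1 :> F by ring.
have Kl x : lower_unipotent x \in K.
  have w_in : sl2 0 1 (- 1) 0 \in SL2 F by rewrite sl2_in.
  suff <- : (upper_unipotent (- x) ^ sl2 0 1 (- 1) 0)%g = lower_unipotent x.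
    by rewrite memJ_norm // (subsetP nK).
  apply: (mulgI (sl2 0 1 (- 1) 0)); rewrite -conjgC.
  rewrite !sl2M ?upper_unipotent_det ?lower_unipotent_det //.
  by congr sl2; ring.
(* For c nonzero, a factorization upper * lower * upper: the entries a, c, d fix the parameters and
   the determinant gives b. *)
have Kc a b c d : a * d - b * c = 1 -> c != 0 -> sl2 a b c d \in K.
  move=> e c0.
  suff -> : sl2 a b c d = (upper_unipotent ((a - 1) / c) * lower_unipotent c
      * upper_unipotent ((d - 1) / c))%g by rewrite !groupM.
  rewrite sl2M ?upper_unipotent_det ?lower_unipotent_det //.
  rewrite sl2M ?upper_unipotent_det //; last by field.
    have -> : b = (a * d - 1) / c by rewrite -e; field.
    by congr sl2; field.
apply/subsetP=> _ /SL2P[a [b [c [d [e ->]]]]].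
have [c0|] := eqVneq c 0; last exact: Kc.
have d0 : d != 0.
  by apply: contra_eq_neq e => ->; rewrite c0 !mulr0 subrr eq_sym oner_neq0.
(* When c = 0, multiplying by [lower_unipotent 1] puts d, which is nonzero, in the lower left
   corner. *)
rewrite -(groupMr _ (Kl 1)) sl2M ?lower_unipotent_det //; apply: Kc.
  by rewrite -[RHS]e; ring.
by rewrite c0 !mulr1 add0r.
Qed.

Definition torus (s : F) := sl2 s 0 0 s^-1.
Arguments torus s%_R.

Lemma torus_det (s : F) : s != 0 -> s * s^-1 - 0 * 0 = 1.
Proof. by move=> s0; rewrite divff // mulr0 subr0. Qed.

Lemma unipotent_torus (s x : F) : s != 0 ->
  (upper_unipotent (s ^+ 2 * x) ^ torus s)%g = upper_unipotent x.
Proof.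
move=> s0; apply: (mulgI (torus s)); rewrite -conjgC.
rewrite /upper_unipotent /torus !sl2M ?upper_unipotent_det ?torus_det //.
by congr sl2; field.
Qed.

Lemma torus_norm (s : F) : s != 0 -> torus s \in 'N(unipotent_set).
Proof.
move=> s0; rewrite inE; apply/subsetP=> _ /imsetP[_ /unipotentP[x ->] ->].
have -> : x = s ^+ 2 * (x / s ^+ 2) by field.
by rewrite unipotent_torus //; apply/unipotentP; exists (x / s ^+ 2).
Qed.

Lemma irr_unipotent_torus (j : Iirr unipotent_group) (s x : F) : s != 0 ->
  'chi_(conjg_Iirr j (torus s)) (upper_unipotent x) = 'chi_j (upper_unipotent (s ^+ 2 * x)).
Proof.
by move=> s0; rewrite conjg_IirrE -(unipotent_torus x s0) cfConjgEJ ?torus_norm.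
Qed.

Lemma lin_unipotent (j : Iirr unipotent_group) : 'chi_j \is a linear_char.
Proof. exact/char_abelianP/unipotent_abelian. Qed.

(* If lambda(s^2 x) = lambda(r^2 x) for all x then lambda is trivial on (s^2 - r^2)F,
   so lambda has at least (q-1)/2 conjugates under the torus. *)
Lemma torus_conjugates (j : Iirr unipotent_group) :
    j != 0 ->
  (#|F|.-1 <= 2 * #|[set conjg_Iirr j (torus s) | s in [set~ 0%R]]|)%N.
Proof.
move=> j0; set D : {set F} := [set~ 0]; pose f s := conjg_Iirr j (torus s).
have inj2 s r : s \in D -> r \in D -> f s = f r -> s = r \/ s = - r.
  rewrite !inE => s0 r0 e; apply/pred2P; rewrite -eqf_sqr -subr_eq0.
  apply: contraR j0 => sr; rewrite -irr_eq1; apply/eqP/cfun_inP=> _ /unipotentP[x ->].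
  have ux y : upper_unipotent y \in unipotent_group by apply/unipotentP; exists y.
  rewrite cfun1E ux; set k := s ^+ 2 - r ^+ 2.
  have k0 : k != 0 by [].
  (* With y = x / k, the character agrees at s^2 y and r^2 y, so its value at x = s^2 y - r^2 y is
     its value at 0. *)
  have -> : x = s ^+ 2 * (x / k) + - (r ^+ 2 * (x / k)) by rewrite /k; field.
  have e' := congr1 (fun i : Iirr _ => 'chi_i (upper_unipotent (x / k))) e.
  rewrite !irr_unipotent_torus // in e'.
  rewrite -upper_unipotentM lin_charM ?lin_unipotent // e'.
  rewrite -lin_charM ?lin_unipotent // upper_unipotentM subrr upper_unipotent0.
  by rewrite lin_char1 ?lin_unipotent.
rewrite -(cardsC1 (0 : F)) -/D.
(* The q - 1 torus parameters are counted by fibres of [f], each contained in some {s, -s}. *)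
rewrite -sum1_card (partition_big_imset f) /= mulnC -sum_nat_const.
apply: leq_sum => _ /imsetP[s Ds ->]; rewrite sum1_card.
apply: leq_trans (_ : #|[set s; - s]| <= _)%N; last by rewrite cards2; case: eqP.
apply: subset_leq_card; apply/subsetP=> r; rewrite !inE => /andP[Dr /eqP e].
by apply/pred2P; apply: inj2.
Qed.

(** The kernel is normal, so containing the unipotents would make it everything. As the torus lies
    in SL(2), conjugate constituents of the restriction have equal multiplicity. *)
Lemma irr1_SL2 (i : Iirr SL2_group) : i != 0 -> #|F|.-1%:R / 2%:R <= 'chi_i 1%g.
Proof.
move=> i0.
have nker : ~~ (unipotent_group \subset cfker 'chi_i).
  apply: contra i0 => sUK; rewrite -subGcfker.
  exact: (normal_unipotent_SL2 (cfker_normal _) sUK).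
have [j j0 phij] := irr_Res_nontriv unipotent_sub_SL2 nker.
rewrite ler_pdivrMr ?ltr0n //.
apply: le_trans (_ : (2 * #|[set conjg_Iirr j (torus s) | s in [set~ 0%R]]|)%:R <= _).
  by rewrite ler_nat torus_conjugates.
rewrite natrM mulrC ler_wpM2r ?ler0n //.
apply: (leq_card_irr_Res unipotent_abelian) => k /imsetP[s]; rewrite !inE => s0 ->.
by rewrite conjg_IirrE cfdot_Res_conjg ?sl2_in ?torus_det.
Qed.

End SL2Degrees.

(** * The counting bound for SL(2,q) in natural numbers *)

Section SL2Counting.
Local Open Scope ring_scope.

Lemma card_tuples_in (gT : finGroupType) (G : {group gT}) t :
  #|tuples_in G t| = (#|G| ^ t)%N.
Proof.
elim: t => [|t IHt].
  rewrite (_ : tuples_in G 0 = setT) ?cardsT ?card_tuple //.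
  by apply/setP=> a; rewrite !inE tuple0.
apply/eqP; rewrite -(eqr_nat algC) -sumr_const sum_tuples_in_cons.
by under eq_bigr do rewrite sumr_const IHt; rewrite sumr_const -mulrnA expnSr.
Qed.

(** The pair of inequalities encodes |N - M| <= E with denominators cleared, a form that passes from
    [algC] to the reals through [nat]. *)
Lemma SL2_nsol_bound (F : finFieldType) s (A B : {set s.+1.-tuple {'GL_2[F]}}) g :
    (1 < #|F|)%N ->
    A \subset tuples_in (SL2_group F) s.+1 -> B \subset tuples_in (SL2_group F) s.+1 ->
    g \in SL2 F ->
  let n := #|SL2 F| in
  let N := (nsol A B g * n * #|F|.-1 ^ s)%N in
  let M := (#|A| * #|B| * #|F|.-1 ^ s)%N in
  let E := (2 ^ s * (n ^ s.+1 * n ^ s.+1))%N in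
  (N <= M + E)%N /\ (M <= N + E)%N.
Proof.
move=> q1 sAG sBG Gg n N M E.
have n0 : (0 : algC) < n%:R by rewrite ltr0n cardG_gt0.
have k0 : (0 : algC) < #|F|.-1%:R by rewrite ltr0n -subn1 subn_gt0.
have m0 : (0 : algC) < #|F|.-1%:R / 2%:R by exact: divr_gt0 k0 (ltr0Sn _ 1).
have := interleaved_mixing m0 (@irr1_SL2 F) sAG sBG Gg.
rewrite -[#|SL2_group F|]/n; set X : algC := _ - _ => leX.
have XR : X \is Num.real by rewrite rpredB ?rpredM ?rpredV ?rpred_nat.
have eX : N%:R - M%:R = X * (n%:R * #|F|.-1%:R ^+ s).
  by rewrite /N /M /X !natrM natrX; field; rewrite gt_eqF.
have card_le (C : {set s.+1.-tuple {'GL_2[F]}}) :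
    C \subset tuples_in (SL2_group F) s.+1 -> (#|C| <= n ^ s.+1)%N.
  by move/subset_leq_card; rewrite card_tuples_in.
have : `|N%:R - M%:R| <= E%:R :> algC.
  rewrite -(@ler_pXn2r _ 2) ?nnegrE ?normr_ge0 ?ler0n //.
  rewrite real_normK ?rpredB ?rpred_nat // eX exprMn.
  apply: le_trans (ler_wpM2r _ leX) _; first by rewrite exprn_ge0 // mulr_ge0 ?exprn_ge0 ?ltW.
  (* Bounding |A||B| by |G|^(2t) makes the right side a perfect square, and yields the power -1 of
     the densities instead of -1/2. *)
  apply: (@le_trans _ _ ((n ^ s.+1)%:R * (n ^ s.+1)%:R * (n%:R ^+ s.+1 * 2%:R ^+ s) ^+ 2)).
    have -> : #|A|%:R * #|B|%:R * (n%:R / (#|F|.-1%:R / 2%:R)) ^+ (2 * s) *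
        (n%:R * #|F|.-1%:R ^+ s) ^+ 2
        = #|A|%:R * #|B|%:R * (n%:R ^+ s.+1 * 2%:R ^+ s) ^+ 2 :> algC.
      rewrite -mulrA mulnC exprM -exprMn; congr (_ * _ ^+ 2).
      have ks0 : (#|F|.-1%:R : algC) ^+ s != 0 by rewrite expf_neq0 ?gt_eqF.
      have ts0 : (2%:R : algC) ^+ s != 0 by rewrite expf_neq0 ?pnatr_eq0.
      rewrite exprS exprMn exprVn exprMn exprVn; field; exact/andP.
    rewrite ler_wpM2r ?exprn_ge0 ?mulr_ge0 ?exprn_ge0 ?ler0n //.
    by rewrite ler_pM ?ler0n ?ler_nat ?card_le.
  by rewrite /E !natrM !natrX le_eqVlt; apply/orP; left; apply/eqP; ring.
rewrite real_ler_norml ?rpredB ?rpred_nat // => /andP[l1 l2].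
split; rewrite -(ler_nat algC) natrD -lerBlDl //.
by rewrite -opprB lerNl.
Qed.

End SL2Counting.

(** * Transfer to the reals and conclusion *)

Local Open Scope R_scope.

Lemma INR_expn m k : INR (m ^ k)%N = INR m ^ k.
Proof. by elim: k => [|k IHk] //; rewrite expnS mult_INR IHk. Qed.

Theorem mainTheorem1 :
  exists C c : R, 0 < C /\ 0 < c /\
  forall (F : finFieldType) (t : nat),
    leq 4 #|F| ->
    leq 2 t ->
    forall A B : {set t.-tuple {'GL_2[F]}},
      (forall a, a \in A -> forall i, tnth a i \in SL2 F) ->
      (forall b, b \in B -> forall i, tnth b i \in SL2 F) ->
      A != set0 -> B != set0 ->
      forall g, g \in SL2 F ->
      let G := INR #|SL2 F| in
      let alpha := INR #|A| / G ^ t in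
      let beta := INR #|B| / G ^ t in
      Rabs (INR (nsol A B g) / (INR #|A| * INR #|B|) - / G)
        <= C * / (alpha * beta) * Rpower G (- (c * INR t)) * / G.
Proof.
(* The exponent 1/32 is the one of [Rpower_le_half_pow]. *)
exists 1, (1 / 32); split; [lra|split; [lra|]].
move=> F [//|s] q4 s1 A B AG BG A0 B0 g Gg G alpha beta.
have sub (C : {set s.+1.-tuple {'GL_2[F]}})
    (CG : forall c, c \in C -> forall i, tnth c i \in SL2 F) :
    C \subset tuples_in (SL2_group F) s.+1.
  by apply/subsetP=> c Cc; apply/tuples_inP=> i; apply: CG.
have q2 : leq 2 #|F| by apply: leq_trans q4.
have leqR m k : leq m k -> INR m <= INR k by move/ssrnat.leP/le_INR.
have ltR m : leq 1 m -> 0 < INR m by move/ssrnat.ltP/lt_0_INR.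
have [/leqR le1 /leqR le2] := SL2_nsol_bound q2 (sub A AG) (sub B BG) Gg.
move: le1 le2; rewrite !plus_INR !mult_INR !INR_expn -/G => le1 le2.
have eq1 : INR #|F| = INR #|F|.-1 + 1 by rewrite -S_INR prednK // ltnW.
apply: (@density_bound _ _ _ _ (INR #|F|.-1)).
- exact/ltR/(cardG_gt0 (SL2_group F)).
- by apply: ltR; rewrite card_gt0.
- by apply: ltR; rewrite card_gt0.
(* q >= 4 puts the base (q - 1)/2 at 3/2 or more, above 1, so its powers give decay. *)
- suff : 4 <= INR #|F| by lra.
  by have := leqR _ _ q4; rewrite /=; lra.
- by rewrite -eq1 -INR_expn; apply/leqR/leq_card_SL2.
- exact: (leqR 1%N s s1).
rewrite -[INR 2]/2 in le1 le2.
have q0 : 0 <= INR #|F|.-1 ^ s by apply/pow_le/pos_INR.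
rewrite -(Rabs_pos_eq _ q0) -Rabs_mult; apply: Rabs_le.
by split; nra.
Qed.
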